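(* Let $f(x)\in\mathbb{Z}[x]$ be monic and irreducible over $\mathbb{Q}$ of degree $6$ with a complex root $\alpha$ such that $\mathbb{Q}(\alpha)/\mathbb{Q}$ is Galois with Galois group $G\cong S_3$, written $G=\langle\sigma,\mu\rangle$ with $\sigma^3=\mu^2=1$, $\mu\sigma\mu=\sigma^2$. Number the roots $\alpha_1=\alpha$, $\alpha_2=\sigma(\alpha)$, $\alpha_3=\sigma^2(\alpha)$, $\alpha_4=\mu(\alpha)$, $\alpha_5=\sigma\mu(\alpha)$, $\alpha_6=\sigma^2\mu(\alpha)$. Let $\chi$ be the irreducible character of degree $2$ of $G$, let $v_1=(1-\sigma-\sigma\mu+\sigma^2\mu)/3$ and $v_2=-(\sigma-\sigma^2-\mu+\sigma\mu)/3$ in $\mathbb{Q}[G]$. Suppose $LR(\chi)\neq\{0\}$. Then there are rational numbers $a,b$ with $(a,b)\neq(0,0)$ such that $$a(\alpha_1-\alpha_2-\alpha_5+\alpha_6)=b(\alpha_2-\alpha_3-\alpha_4+\alpha_5),$$ and for such $a,b$ the elements $av_1+bv_2$ and $\sigma(av_1+bv_2)$ form a basis of $LR(\chi)$ over $\mathbb{Q}$; the corresponding linear relations $M[\alpha]=0$ ($M\in LR(\chi)$) are spanned by $a(\alpha_1-\alpha_2-\alpha_5+\alpha_6)+b(-\alpha_2+\alpha_3+\alpha_4-\alpha_5)=0$ and $a(\alpha_2-\alpha_3+\alpha_4-\alpha_6)+b(\alpha_1-\alpha_3+\alpha_5-\alpha_6)=0$.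
   Context: For $M=\sum_{g\in G}m_g g\in\mathbb{C}[G]$ put $M[\alpha]=\sum_g m_g g(\alpha)$. The degree-$2$ irreducible character $\chi$ of $S_3$ is rational-valued ($\chi(1)=2,\chi(\sigma)=-1,\chi(\mu)=0$) and its central idempotent is $c_\chi=C(\chi)=\frac13(2-\sigma-\sigma^2)\in\mathbb{Q}[G]$. Define $LR(\chi)=\{M\in\mathbb{Q}[G]: M=Mc_\chi,\ M\cdot(\sum_{g\in G}g(\alpha)g^{-1})=0\}$, the product taken in $\mathbb{C}[G]$. *)

(* Defs.v *)
From HB Require Import structures.
From mathcomp Require Import all_boot all_order all_algebra all_fingroup.
From mathcomp Require Import all_solvable all_field all_character.
From mathcomp Require Import reals complex.

Set Implicit Arguments.
Unset Strict Implicit.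
Unset Printing Implicit Defensive.

Import GroupScope GRing.Theory.

Local Open Scope ring_scope.

(** * The group algebra [R[G]] of a finite group *)

(* The alias hides the pointwise product carried by [{ffun gT -> R}]; [R^o]
   makes [R] a module over itself, so that the scaling is coefficientwise. *)
Definition galg (R : comNzRingType) (gT : finGroupType) : Type :=
  {ffun gT -> R^o}.

Section GroupAlgebra.

Variables (R : comNzRingType) (gT : finGroupType).

HB.instance Definition _ := Vector.copy (galg R gT) {ffun gT -> R^o}.

Implicit Types M N P : galg R gT.

Definition galg_coef M : gT -> R := fun_of_fin M.

Definition galg_elt (g : gT) : galg R gT := [ffun h => (h == g)%:R].

Definition galg_mul M N : galg R gT :=
  [ffun k => \sum_h galg_coef M h * galg_coef N (h^-1 * k)%g].

Fact galg_mulA : associative galg_mul.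
Proof.
move=> M N P; apply/ffunP => k; rewrite !ffunE /galg_coef.
under eq_bigr do rewrite ffunE big_distrr /=.
under [RHS]eq_bigr do rewrite ffunE big_distrl /=.
rewrite [RHS]exchange_big /=; apply: eq_bigr => h _.
rewrite [RHS](reindex_inj (mulgI h)) /=; apply: eq_bigr => l _.
by rewrite mulKg invMg !mulgA mulrA.
Qed.

Fact galg_mul1r : left_id (galg_elt 1) galg_mul.
Proof.
move=> M; apply/ffunP => k; rewrite !ffunE (bigD1 1%g) //= big1 => [|h h1].
  by rewrite /galg_coef ffunE eqxx mul1r addr0 invg1 mul1g.
by rewrite /galg_coef ffunE (negPf h1) mul0r.
Qed.

Fact galg_mulr1 : right_id (galg_elt 1) galg_mul.
Proof.
move=> M; apply/ffunP => k; rewrite !ffunE (bigD1 k) //= big1 => [|h hk].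
  by rewrite /galg_coef ffunE mulVg eqxx mulr1 addr0.
by rewrite /galg_coef ffunE -eq_mulVg1 (negPf hk) mulr0.
Qed.

Fact galg_mulDl : left_distributive galg_mul +%R.
Proof.
move=> M N P; apply/ffunP => k; rewrite !ffunE -big_split /=.
by apply: eq_bigr => h _; rewrite /galg_coef ffunE mulrDl.
Qed.

Fact galg_mulDr : right_distributive galg_mul +%R.
Proof.
move=> M N P; apply/ffunP => k; rewrite !ffunE -big_split /=.
by apply: eq_bigr => h _; rewrite /galg_coef ffunE mulrDr.
Qed.

Fact galg_1neq0 : galg_elt 1 != 0.
Proof.
by apply/eqP => /ffunP/(_ 1%g)/eqP; rewrite !ffunE eqxx oner_eq0.
Qed.

HB.instance Definition _ := GRing.Zmodule_isNzRing.Build (galg R gT)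
  galg_mulA galg_mul1r galg_mulr1 galg_mulDl galg_mulDr galg_1neq0.

Fact galg_scaleAl (a : R) M N : a *: (M * N) = (a *: M) * N.
Proof.
apply/ffunP => k; rewrite !ffunE scaler_sumr.
by apply: eq_bigr => h _; rewrite /galg_coef ffunE; apply: mulrA.
Qed.

HB.instance Definition _ :=
  GRing.Lmodule_isLalgebra.Build R (galg R gT) galg_scaleAl.

Fact galg_scaleAr (a : R) M N : a *: (M * N) = M * (a *: N).
Proof.
apply/ffunP => k; rewrite !ffunE scaler_sumr.
by apply: eq_bigr => h _; rewrite /galg_coef ffunE; apply: mulrCA.
Qed.

HB.instance Definition _ :=
  GRing.Lalgebra_isAlgebra.Build R (galg R gT) galg_scaleAr.

End GroupAlgebra.

Arguments galg_elt {R gT} g.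

Definition map_galg (R S : comNzRingType) (gT : finGroupType) (f : R -> S)
    (M : galg R gT) : galg S gT :=
  [ffun g => f (galg_coef M g)].

(* The central idempotent [chi(1)/#|G| * \sum_g chi(g^-1) g] of [C[G]]; character
   values are algebraic, so it is formed in [algC[G]]. *)
Definition central_idempotent (gT : finGroupType) (chi : 'CF([set: gT])) :
    galg algC gT :=
  (chi 1%g / #|gT|%:R) *: \sum_g chi g^-1%g *: galg_elt g.

(** * The Galois group under composition *)

(* In [gal_of K] the product [g * h] acts as [h \o g] (see [galM]).  The same
   type is given here the opposite group law, so that [g * h] acts as [g \o h].
   For [L] over [F], this is the Galois group of [K] over the base field [F]. *)
Definition galc (F : fieldType) (L : splittingFieldType F) (K : {vspace L}) :
  Type := gal_of K.

Section CompositionGaloisGroup.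

Variables (F : fieldType) (L : splittingFieldType F) (K : {vspace L}).

HB.instance Definition _ := Finite.copy (galc K) (gal_of K).

Definition galc_mul (g h : galc K) : galc K :=
  ((h : gal_of K) * (g : gal_of K))%g.
Definition galc_one : galc K := (1%g : gal_of K).
Definition galc_inv (g : galc K) : galc K := (g : gal_of K)^-1%g.

Fact galc_mulA : associative galc_mul.
Proof. by move=> g h k; rewrite /galc_mul mulgA. Qed.
Fact galc_mul1g : left_id galc_one galc_mul.
Proof. by move=> g; rewrite /galc_mul mulg1. Qed.
Fact galc_mulVg : left_inverse galc_one galc_inv galc_mul.
Proof. by move=> g; rewrite /galc_mul mulgV. Qed.

HB.instance Definition _ :=
  Finite_isGroup.Build (galc K) galc_mulA galc_mul1g galc_mulVg.

Definition galc_act (g : galc K) (y : L) : L := (g : gal_of K) y.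

End CompositionGaloisGroup.

Lemma galc_actM (F : fieldType) (L : splittingFieldType F) (K : {subfield L})
    (g h : galc K) (y : L) :
  y \in K -> galc_act (g * h)%g y = galc_act g (galc_act h y).
Proof. exact: galM. Qed.

Lemma gal_over_base (F : fieldType) (L : splittingFieldType F)
    (K : {subfield L}) :
  'Gal(K / 1) = [set: gal_of K].
Proof.
by apply/setP=> g; rewrite inE gal_kHom ?sub1v // k1HomE ahomWin.
Qed.

(** * Linear relations among conjugates *)

Section LinearRelations.

Variables (C : fieldType) (L : splittingFieldType rat).
Variables (iota : {rmorphism L -> C}) (K : {vspace L}) (x : L).

(* [iota] realises [L] inside [C]; the algebraic number under study is
   [alpha = iota x] and its conjugates are the [g(alpha)]. *)
Definition conj_root (g : galc K) : C := iota (galc_act g x).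

(* [M[alpha]] *)
Definition galg_eval (M : galg C (galc K)) : C :=
  \sum_g galg_coef M g * conj_root g.

(* [\sum_g g(alpha) g^-1] *)
Definition galg_resolvent : galg C (galc K) :=
  \sum_g conj_root g *: galg_elt g^-1%g.

Definition LR (chi : 'CF([set: galc K])) (M : galg rat (galc K)) : Prop :=
  map_galg ratr M = map_galg ratr M * central_idempotent chi /\
  map_galg ratr M * galg_resolvent = 0.

End LinearRelations.

Definition is_basis (F : fieldType) (V : vectType F) (P : V -> Prop)
    (X : seq V) : Prop :=
  free X /\ forall v, P v <-> v \in <<X>>%VS.

(* The formal linear relation [\sum_i M_(g_i) X_i] attached to [M], as the row of
   its coefficients, where [g_i] is the automorphism sending the first root to
   the [i]-th one. *)
Definition relation_row (R : comNzRingType) (gT : finGroupType) (n : nat)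
    (g : 'I_n -> gT) (M : galg R gT) : 'rV[R]_n :=
  \row_i galg_coef M (g i).

(* Main.v *)
(** The relations in LR(chi) form a left ideal I of Q[G], contained in the
    elements M with M c_chi = M.  On the plane spanned by v1 and v2, mu and
    sigma act in the same way, and every M with M c_chi = M is uniquely
    w + sigma w' with w, w' in that plane.  If M is in I, then 3 w' is equal to
    (1 - sigma) (mu - sigma) M, so that w' and w are in I as well.  Thus I is
    determined by its intersection with the plane: that intersection is not 0
    since I is not 0, and it is not the whole plane, since otherwise
    1 - sigma = v1 + v2 - sigma v1 + 2 sigma v2 would be in I and sigma would
    fix alpha. *)

Require Import Defs.
From HB Require Import structures.
From mathcomp Require Import all_boot all_order all_algebra all_fingroup.
From mathcomp Require Import all_solvable all_field all_character.
From mathcomp Require Import reals complex.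
From mathcomp Require Import ring lra.
Set Implicit Arguments.
Unset Strict Implicit.
Unset Printing Implicit Defensive.

Import GroupScope GRing.Theory Num.Theory.
Local Open Scope ring_scope.

(** * Coefficients in a group algebra and change of scalars *)

Section GroupAlgebraTheory.

Variables (R : comNzRingType) (gT : finGroupType).
Implicit Types (M N : galg R gT) (g h : gT).

Lemma galg_coefD M N g :
  galg_coef (M + N) g = galg_coef M g + galg_coef N g.
Proof. by rewrite /galg_coef ffunE. Qed.

Lemma galg_coefN M g : galg_coef (- M) g = - galg_coef M g.
Proof. by rewrite /galg_coef ffunE. Qed.

Lemma galg_coefZ a M g : galg_coef (a *: M) g = a * galg_coef M g.
Proof. by rewrite /galg_coef ffunE. Qed.

Lemma galg_coef_sum (I : finType) (F : I -> galg R gT) g :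
  galg_coef (\sum_i F i) g = \sum_i galg_coef (F i) g.
Proof. by rewrite /galg_coef sum_ffunE. Qed.

Lemma galg_coef_elt g h : galg_coef (galg_elt g : galg R gT) h = (h == g)%:R.
Proof. by rewrite /galg_coef ffunE. Qed.

Lemma galg_coefM M N g :
  galg_coef (M * N) g = \sum_h galg_coef M h * galg_coef N (h^-1 * g)%g.
Proof. by rewrite {1}/galg_coef ffunE. Qed.

Lemma galg_coefMl g M h :
  galg_coef (galg_elt g * M) h = galg_coef M (g^-1 * h)%g.
Proof.
rewrite galg_coefM (bigD1 g) //= big1 ?addr0 => [|k /negPf kg].
  by rewrite galg_coef_elt eqxx mul1r.
by rewrite galg_coef_elt kg mul0r.
Qed.

Lemma galg_coefMr g M h :
  galg_coef (M * galg_elt g) h = galg_coef M (h * g^-1)%g.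
Proof.
rewrite galg_coefM (bigD1 (h * g^-1)%g) //= big1 ?addr0 => [|k].
  by rewrite galg_coef_elt invMg invgK mulgKV eqxx mulr1.
move=> kg; rewrite galg_coef_elt; case: (_ =P g) kg => [<-|_ _];
  last by rewrite mulr0.
by rewrite invMg invgK mulgA mulgV mul1g eqxx.
Qed.

Lemma galg_eqP M N : galg_coef M =1 galg_coef N -> M = N.
Proof. by move=> eMN; apply/ffunP. Qed.

End GroupAlgebraTheory.

Definition galg_coefE :=
  (galg_coefD, galg_coefN, galg_coefZ, galg_coefMl, galg_coefMr).

Lemma galg_coef_map (R S : comNzRingType) (f : R -> S) (gT : finGroupType)
    (M : galg R gT) g : galg_coef (map_galg f M) g = f (galg_coef M g).
Proof. by rewrite /galg_coef ffunE. Qed.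

Lemma map_galgM (R S : comNzRingType) (f : {rmorphism R -> S})
    (gT : finGroupType) (M N : galg R gT) :
  map_galg f (M * N) = map_galg f M * map_galg f N.
Proof.
apply: galg_eqP => g; rewrite galg_coef_map !galg_coefM rmorph_sum /=.
by apply: eq_bigr => h _; rewrite rmorphM !galg_coef_map.
Qed.

Lemma map_galg_inj (R S : comNzRingType) (f : R -> S) (gT : finGroupType) :
  injective f -> injective (@map_galg R S gT f).
Proof.
move=> f_inj M N eMN; apply: galg_eqP => g.
by apply: f_inj; rewrite -!galg_coef_map eMN.
Qed.

(** * Normal forms and multiplication in S_3 *)

Section S3.

Variables (gT : finGroupType) (sigma mu : gT).
Hypotheses (cardG : #|[set: gT]| = 6%N)
  (genG : <<[set sigma; mu]>>%g = [set: gT])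
  (sigma3 : (sigma ^+ 3 = 1)%g) (mu2 : (mu ^+ 2 = 1)%g)
  (mu_sigma_mu : (mu * sigma * mu = sigma ^+ 2)%g).

Local Notation elts :=
  [:: 1; sigma; sigma ^+ 2; mu; sigma * mu; sigma ^+ 2 * mu]%g.

Lemma s3_invs : (sigma^-1 = sigma ^+ 2)%g.
Proof. by apply/eqP; rewrite eq_invg_mul -expgS sigma3. Qed.

Lemma s3_invm : (mu^-1 = mu)%g.
Proof. by apply/eqP; rewrite eq_invg_mul -expg2 mu2. Qed.

Lemma s3_mus : (mu * sigma = sigma ^+ 2 * mu)%g.
Proof. by rewrite -mu_sigma_mu -[RHS]mulgA -expg2 mu2 mulg1. Qed.

Lemma s3_muss : (mu * sigma ^+ 2 = sigma * mu)%g.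
Proof.
by rewrite !expg2 mulgA s3_mus -mulgA s3_mus mulgA -expgD -(expg_mod _ sigma3).
Qed.

(** Since [mu] normalises [<[sigma]>], the join of the two cyclic groups is their product, so every
    element is some [sigma ^+ i * mu ^+ j], with exponents reducible modulo 3 and 2. *)
Lemma s3_mem (g : gT) : g \in elts.
Proof.
have nms : <[mu]>%g \subset 'N(<[sigma]>)%g.
  rewrite cycle_subG; apply/normP; rewrite -genJ conjg_set1.
  by rewrite conjgE s3_invm mulgA mu_sigma_mu -s3_invs -[in RHS]cycleV.
have: (g \in <[sigma]> * <[mu]>)%g.
  by rewrite -norm_joinEr // joing_idl joing_idr [(_ <*> _)%g]genG inE.
case/mulsgP => _ _ /cycleP[i ->] /cycleP[j ->] ->.
rewrite -(expg_mod i sigma3) -(expg_mod j mu2).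
have: (i %% 3 < 3)%N by rewrite ltn_mod.
have: (j %% 2 < 2)%N by rewrite ltn_mod.
case: (j %% 2)%N => [|[|//]] _; case: (i %% 3)%N => [|[|[|//]]] _;
by rewrite ?expg0 ?expg1 ?mul1g ?mulg1 !inE eqxx ?orbT.
Qed.

(** Six entries exhaust a group of order 6, so none repeats. *)
Lemma s3_uniq : uniq elts.
Proof.
apply/card_uniqP; rewrite -[RHS]cardG cardsT.
by apply: eq_card => g; rewrite s3_mem.
Qed.

Lemma s3_sum (V : nmodType) (F : gT -> V) :
  \sum_g F g = F 1%g + (F sigma + (F (sigma ^+ 2)%g + (F mu
    + (F (sigma * mu)%g + F (sigma ^+ 2 * mu)%g)))).
Proof.
rewrite -big_enum /= (perm_big elts) ?unlock /= ?addr0 //.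
apply: uniq_perm; rewrite ?enum_uniq ?s3_uniq // => g.
by rewrite mem_enum s3_mem.
Qed.

Lemma s3_forall (P : gT -> Prop) :
  P 1%g -> P sigma -> P (sigma ^+ 2)%g -> P mu -> P (sigma * mu)%g ->
  P (sigma ^+ 2 * mu)%g -> forall g, P g.
Proof.
move=> ? ? ? ? ? ? g; have := s3_mem g; rewrite !inE.
by do 5![case/orP => [/eqP->//|]] => /eqP->.
Qed.

Local Notation neq g h := (((g == h) = false) * ((h == g) = false))%type.

(** Both orientations are listed so that, together with [eqxx], rewriting evaluates any coefficient
    of a [galg_elt]. *)
Lemma s3_eqF :
  (neq 1%g sigma * neq 1%g (sigma ^+ 2)%g * neq 1%g mu
  * neq 1%g (sigma * mu)%g * neq 1%g (sigma ^+ 2 * mu)%g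
  * neq sigma (sigma ^+ 2)%g * neq sigma mu * neq sigma (sigma * mu)%g
  * neq sigma (sigma ^+ 2 * mu)%g * neq (sigma ^+ 2)%g mu
  * neq (sigma ^+ 2)%g (sigma * mu)%g
  * neq (sigma ^+ 2)%g (sigma ^+ 2 * mu)%g
  * neq mu (sigma * mu)%g * neq mu (sigma ^+ 2 * mu)%g
  * neq (sigma * mu)%g (sigma ^+ 2 * mu)%g)%type.
Proof.
have := s3_uniq; rewrite /= !inE !negb_or -!andbA.
do 14![case/andP=> /negPf ?] => /andP[/negPf ? _].
by do !split; rewrite // eq_sym.
Qed.

(** These are the arguments produced by [galg_coefMl] for left multiplication by [sigma] or [mu],
    and by [galg_coefMr] for right multiplication by [sigma] or [sigma ^+ 2]. *)
Lemma s3_mulE :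
  ((sigma^-1 * 1 = sigma ^+ 2)%g
  * (sigma^-1 * sigma = 1)%g
  * (sigma^-1 * sigma ^+ 2 = sigma)%g
  * (sigma^-1 * mu = sigma ^+ 2 * mu)%g
  * (sigma^-1 * (sigma * mu) = mu)%g
  * (sigma^-1 * (sigma ^+ 2 * mu) = sigma * mu)%g
  * (mu^-1 * 1 = mu)%g
  * (mu^-1 * sigma = sigma ^+ 2 * mu)%g
  * (mu^-1 * sigma ^+ 2 = sigma * mu)%g
  * (mu^-1 * mu = 1)%g
  * (mu^-1 * (sigma * mu) = sigma ^+ 2)%g
  * (mu^-1 * (sigma ^+ 2 * mu) = sigma)%g
  * (1 * sigma^-1 = sigma ^+ 2)%g
  * (sigma * sigma^-1 = 1)%g
  * (sigma ^+ 2 * sigma^-1 = sigma)%g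
  * (mu * sigma^-1 = sigma * mu)%g
  * (sigma * mu * sigma^-1 = sigma ^+ 2 * mu)%g
  * (sigma ^+ 2 * mu * sigma^-1 = mu)%g
  * (1 * (sigma ^+ 2)^-1 = sigma)%g
  * (sigma * (sigma ^+ 2)^-1 = sigma ^+ 2)%g
  * (sigma ^+ 2 * (sigma ^+ 2)^-1 = 1)%g
  * (mu * (sigma ^+ 2)^-1 = sigma ^+ 2 * mu)%g
  * (sigma * mu * (sigma ^+ 2)^-1 = mu)%g
  * (sigma ^+ 2 * mu * (sigma ^+ 2)^-1 = sigma * mu)%g)%type.
Proof.
have ss: (sigma * sigma = sigma ^+ 2)%g by [].
have s2s: (sigma ^+ 2 * sigma = 1)%g by rewrite -expgSr.
have ss2: (sigma * sigma ^+ 2 = 1)%g by rewrite -expgS.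
have s2s2: (sigma ^+ 2 * sigma ^+ 2 = sigma)%g.
  by rewrite -expgD -(expg_mod _ sigma3).
have mm: (mu * mu = 1)%g by [].
have sV2: ((sigma ^+ 2)^-1 = sigma)%g by rewrite -s3_invs invgK.
rewrite sV2 s3_invs s3_invm.
have s2sA g : (sigma ^+ 2 * (sigma * g) = g)%g by rewrite mulgA s2s mul1g.
have s2s2A g : (sigma ^+ 2 * (sigma ^+ 2 * g) = sigma * g)%g.
  by rewrite mulgA s2s2.
have ssA g : (sigma * (sigma * g) = sigma ^+ 2 * g)%g by rewrite mulgA.
have ss2A g : (sigma * (sigma ^+ 2 * g) = g)%g by rewrite mulgA ss2 mul1g.
have mA g : (mu * (sigma * g) = sigma ^+ 2 * (mu * g))%g.
  by rewrite mulgA s3_mus -mulgA.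
have m2A g : (mu * (sigma ^+ 2 * g) = sigma * (mu * g))%g.
  by rewrite mulgA s3_muss -mulgA.
by do !split; rewrite -?mulgA ?(s3_mus, s3_muss, mA, m2A, s2sA, s2s2A, ssA,
  ss2A, ss, s2s, ss2, s2s2, mm, mulg1, mul1g).
Qed.

(** * The plane spanned by v1 and v2 in Q[S_3] *)

Local Notation e := (@galg_elt rat gT).

Definition s3_v1 : galg rat gT :=
  3%:R^-1 *: (e 1%g - e sigma - e (sigma * mu)%g + e (sigma ^+ 2 * mu)%g).

Definition s3_v2 : galg rat gT := - (3%:R^-1 *:
  (e sigma - e (sigma ^+ 2)%g - e mu + e (sigma * mu)%g)).

(** The rational form of the central idempotent of the character of degree 2;
    [s3_central_idempotent] makes the link. *)
Definition s3_c : galg rat gT :=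
  3%:R^-1 *: (2%:R *: e 1%g - e sigma - e (sigma ^+ 2)%g).

Definition s3_w (a b : rat) : galg rat gT := a *: s3_v1 + b *: s3_v2.

Lemma s3_wD a b c d : s3_w a b + s3_w c d = s3_w (a + c) (b + d).
Proof. by rewrite /s3_w !scalerDl addrACA. Qed.

Lemma s3_wZ t a b : t *: s3_w a b = s3_w (t * a) (t * b).
Proof. by rewrite /s3_w scalerDr !scalerA. Qed.

Lemma s3_mulr_c (M : galg rat gT) g : galg_coef (M * s3_c) g =
  3%:R^-1 * (2%:R * galg_coef M g - galg_coef M (g * sigma^-1)%g
    - galg_coef M (g * (sigma ^+ 2)^-1)%g).
Proof.
by rewrite /s3_c -scalerAr !mulrBr -scalerAr !galg_coefE invg1 mulg1; ring.
Qed.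

(** As 1 - c = (1 + sigma + sigma^2) / 3, the condition M c = M says that the coefficients of M sum
    to 0 on each of the two left cosets of [<[sigma]>]. *)
Lemma s3_coset_sums (M : galg rat gT) : M * s3_c = M ->
  galg_coef M (sigma ^+ 2)%g = - galg_coef M 1%g - galg_coef M sigma /\
  galg_coef M (sigma ^+ 2 * mu)%g
    = - galg_coef M mu - galg_coef M (sigma * mu)%g.
Proof.
move=> Mc; have := s3_mulr_c M mu; have := s3_mulr_c M 1%g.
by rewrite Mc !s3_mulE => eM1 eMmu; split; lra.
Qed.

Lemma s3_coef_w (a b : rat) :
  ((galg_coef (s3_w a b) 1%g = a / 3%:R)
  * (galg_coef (s3_w a b) sigma = (- a - b) / 3%:R)
  * (galg_coef (s3_w a b) (sigma ^+ 2)%g = b / 3%:R)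
  * (galg_coef (s3_w a b) mu = b / 3%:R)
  * (galg_coef (s3_w a b) (sigma * mu)%g = (- a - b) / 3%:R)
  * (galg_coef (s3_w a b) (sigma ^+ 2 * mu)%g = a / 3%:R))%type.
Proof.
rewrite /s3_w /s3_v1 /s3_v2 !galg_coefE !galg_coef_elt !eqxx !s3_eqF /=.
by do !split; field.
Qed.

Lemma s3_coef_sigma_w (a b : rat) :
  ((galg_coef (e sigma * s3_w a b)%R 1%g = b / 3%:R)
  * (galg_coef (e sigma * s3_w a b)%R sigma = a / 3%:R)
  * (galg_coef (e sigma * s3_w a b)%R (sigma ^+ 2)%g = (- a - b) / 3%:R)
  * (galg_coef (e sigma * s3_w a b)%R mu = a / 3%:R)
  * (galg_coef (e sigma * s3_w a b)%R (sigma * mu)%g = b / 3%:R)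
  * (galg_coef (e sigma * s3_w a b)%R (sigma ^+ 2 * mu)%g
      = (- a - b) / 3%:R))%type.
Proof. by do !split; rewrite galg_coefMl s3_mulE s3_coef_w. Qed.

Lemma s3_w_c a b : s3_w a b * s3_c = s3_w a b.
Proof.
apply: galg_eqP; apply: s3_forall; rewrite s3_mulr_c !s3_mulE !s3_coef_w;
by field.
Qed.

(* As mu w = sigma w for every w = s3_w a b, the element
   M = w_p + sigma w_q satisfies (mu - sigma) M = (1 - sigma^2) w_q, and
   (1 - sigma) (1 - sigma^2) acts as 3 on s3_c-invariant elements. *)
Lemma s3_decomp (M : galg rat gT) : M * s3_c = M ->
  exists p q : rat * rat,
    M = s3_w p.1 p.2 + e sigma * s3_w q.1 q.2 /\
    s3_w q.1 q.2
      = 3%:R^-1 *: ((e 1%g - e sigma) * ((e mu - e sigma) * M)).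
Proof.
case/s3_coset_sums.
set m0 := galg_coef M 1%g; set m1 := galg_coef M sigma.
set m3 := galg_coef M mu; set m4 := galg_coef M (sigma * mu)%g.
move=> m2E m5E.
(* Comparing coefficients, m0 - m4 = (2 p.1 + p.2) / 3 and m3 - m1 = (p.1 + 2 p.2) / 3 are free of q
   and determine p; then 3 m3 = p.2 + q.1 and 3 m0 = p.1 + q.2 determine q. *)
exists (2%:R * (m0 - m4) - (m3 - m1), 2%:R * (m3 - m1) - (m0 - m4)).
exists (3%:R * m3 - (2%:R * (m3 - m1) - (m0 - m4)),
        3%:R * m0 - (2%:R * (m0 - m4) - (m3 - m1))).
split; apply: galg_eqP; apply: s3_forall; rewrite ?mulrBl ?mulrBr.
1-6: rewrite galg_coefD /= s3_coef_w s3_coef_sigma_w.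
7-12: rewrite s3_coef_w galg_coefZ !galg_coefE invg1 !mul1g !s3_mulE /=.
all: by rewrite ?m2E ?m5E -?/m0 -?/m1 -?/m3 -?/m4; field.
Qed.

Lemma s3_w_free a b : (a, b) <> (0, 0) ->
  free [:: s3_w a b; e sigma * s3_w a b].
Proof.
move=> ab0; rewrite free_cons span_seq1 seq1_free.
apply/andP; split; last first.
  apply/eqP=> w0; case: ab0.
  have h g : galg_coef (e sigma * s3_w a b)%R g = 0.
    by rewrite w0 /galg_coef ffunE.
  have := h mu; have := h 1%g; rewrite !s3_coef_sigma_w ?s3_coef_w => ? ?.
  by congr (_, _); lra.
apply/negP=> /vlineP[t wE]; case: ab0.
have h g : galg_coef (s3_w a b) g = t * galg_coef (e sigma * s3_w a b)%R g.
  by rewrite {1}wE galg_coefZ.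
(* The unknown t drops out linearly: the right-hand sides agree at [sigma] and [mu], giving - a - b
   = b, and at [sigma ^+ 2] and [sigma ^+ 2 * mu], giving b = a. *)
move: (h 1%g) (h sigma) (h (sigma ^+ 2)%g) (h mu) (h (sigma ^+ 2 * mu)%g).
rewrite !s3_coef_sigma_w ?s3_coef_w => ? ? ? ? ?.
by congr (_, _); lra.
Qed.

(** * Left ideals inside Q[G] c that omit 1 - sigma *)

Section LeftIdeal.

Variable I : galg rat gT -> Prop.
Hypotheses (idealD : forall M N, I M -> I N -> I (M + N))
  (idealM : forall M N, I M -> I (N * M))
  (ideal_c : forall M, I M -> M * s3_c = M)
  (ideal_1B : ~ I (e 1%g - e sigma)).

Lemma s3_idealZ a M : I M -> I (a *: M).
Proof. by move=> IM; rewrite -[M]mul1r scalerAl; apply: idealM. Qed.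

Lemma s3_idealB M N : I M -> I N -> I (M - N).
Proof. by move=> IM IN; rewrite -scaleN1r; apply/idealD/s3_idealZ. Qed.

(** The second equation of [s3_decomp] exhibits w_q as a left multiple of M, so it lies in I; hence
    so does w_p = M - sigma w_q. *)
Lemma s3_ideal_decomp M : I M ->
  exists p q : rat * rat, [/\ M = s3_w p.1 p.2 + e sigma * s3_w q.1 q.2,
    I (s3_w p.1 p.2) & I (s3_w q.1 q.2)].
Proof.
move=> IM; have [p [q [eM eq]]] := s3_decomp (ideal_c IM); exists p, q.
have Iq: I (s3_w q.1 q.2).
  by rewrite eq; apply: s3_idealZ; apply: idealM; apply: idealM.
split=> //; have -> : s3_w p.1 p.2 = M - e sigma * s3_w q.1 q.2.
  by rewrite eM addrK.
exact/s3_idealB/idealM.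
Qed.

Lemma s3_ideal_line a b c d : I (s3_w a b) -> I (s3_w c d) -> a * d = b * c.
Proof.
move=> Iab Icd; apply/eqP; rewrite -subr_eq0; apply/negP=> /negP D0.
set D := a * d - b * c in D0.
have Iw x y : I (s3_w x y).
  (* Cramer's rule: with D nonzero, the two given elements span the whole plane. *)
  pose t := (x * d - y * c) / D; pose u := (a * y - b * x) / D.
  have -> : s3_w x y = s3_w (t * a + u * c) (t * b + u * d).
    by congr s3_w; rewrite /t /u /D; field; rewrite D0.
  by rewrite -s3_wD -!s3_wZ; apply: idealD; apply: s3_idealZ.
apply: ideal_1B.
(* The coordinates are the witnesses of [s3_decomp] at m0 = 1, m1 = -1, m3 = m4 = 0. *)
have -> : e 1%g - e sigma = s3_w 1 1 + e sigma * s3_w (-1) 2%:R.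
  apply: galg_eqP; apply: s3_forall;
    rewrite galg_coefD galg_coefN [RHS]galg_coefD !galg_coef_elt;
    by rewrite ?eqxx ?s3_eqF s3_coef_w s3_coef_sigma_w /=; field.
by apply: idealD; last apply: idealM.
Qed.

Lemma s3_ideal_exists M : I M -> M <> 0 ->
  exists a b, (a, b) <> (0, 0) /\ I (s3_w a b).
Proof.
move=> IM M0; have [[a b] [[c d] [/= eM Iab Icd]]] := s3_ideal_decomp IM.
have [[a0 b0] | ab0] := eqVneq (a, b) (0, 0); last first.
  by exists a, b; split=> //; apply/eqP.
exists c, d; split=> [[c0 d0]|//]; apply: M0.
by rewrite eM a0 b0 c0 d0 /s3_w !scale0r addr0 mulr0 addr0.
Qed.

Lemma s3_ideal_basis a b : (a, b) <> (0, 0) -> I (s3_w a b) ->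
  is_basis I [:: s3_w a b; e sigma * s3_w a b].
Proof.
move=> ab0 Iw; split=> [|M]; first exact: s3_w_free.
rewrite span_cons span_seq1; split=> [IM|].
  have [[c d] [[c' d'] [/= -> Icd Icd']]] := s3_ideal_decomp IM.
  (* The vanishing determinant of [s3_ideal_line] makes (x, y) proportional to (a, b); the ratio is
     read off a nonzero coordinate of (a, b). *)
  have line x y : I (s3_w x y) -> exists t, s3_w x y = t *: s3_w a b.
    move=> Ixy; have D := s3_ideal_line Iw Ixy.
    have [a0 | a0] := eqVneq a 0.
      have b0 : b != 0 by apply/eqP=> b0; apply: ab0; rewrite a0 b0.
      have x0 : x = 0 by apply: (mulfI b0); rewrite mulr0 -D a0 mul0r.
      by exists (y / b); rewrite [RHS]s3_wZ a0 x0 mulr0 mulfVK.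
    exists (x / a); rewrite [RHS]s3_wZ mulfVK // -mulrA [_ * b]mulrC mulrA.
    by rewrite [x * b]mulrC -D mulrAC mulfV ?mul1r.
  have [t ->] := line _ _ Icd; have [t' ->] := line _ _ Icd'.
  rewrite -scalerAr; apply: memv_add; exact: memvZ (memv_line _).
case/memv_addP => _ /vlineP[t ->] [_ /vlineP[t' ->] ->].
by apply: idealD; apply: s3_idealZ => //; apply: idealM.
Qed.

End LeftIdeal.

(** * The values and the idempotent of the character of degree 2 *)

Section Character.

Variable chi : 'CF([set: gT]).
Hypotheses (irr_chi : chi \in irr [set: gT]) (chi1 : chi 1%g = 2%:R).

(* With s = chi sigma and m = chi mu, the relations '[chi, 1] = 0 and
   '[chi, chi] = 1 leave only m = 0 or m = - 4 / 5, and the latter is not an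
   algebraic integer. *)
Lemma s3_chiE g : chi g^-1%g = ratr (3%:R * galg_coef s3_c g).
Proof.
have chiJ h k : chi (h ^ k)%g = chi h by apply: cfunJ; rewrite inE.
have chi_sigma2 : chi (sigma ^+ 2)%g = chi sigma.
  by rewrite -mu_sigma_mu -[in RHS](chiJ sigma mu) conjgE s3_invm mulgA.
have chi_sm : chi (sigma * mu)%g = chi mu.
  by rewrite -(chiJ mu sigma) conjgE s3_mus s3_mulE.
have chi_s2m : chi (sigma ^+ 2 * mu)%g = chi mu.
  by rewrite -chi_sm -(chiJ (sigma * mu)%g sigma) conjgE mulgA mulKg s3_mus.
have [i chi_i] := irrP irr_chi.
have char_chi : chi \is a character by rewrite chi_i irr_char.
(* Complex conjugation gives the value at the inverse; [sigma] is conjugate to its inverse and [mu]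
   equals its own, so the norm of chi involves plain squares only. *)
have conj_s : ((chi sigma)^* = chi sigma)%R.
  by rewrite -char_inv // s3_invs.
have conj_m : ((chi mu)^* = chi mu)%R by rewrite -char_inv // s3_invm.
have chi_i0 : i != 0.
  apply: contra_eq_neq chi1 => i0.
  by rewrite chi_i i0 irr0 cfun11 (eqr_nat _ 1 2).
have sumG (F : gT -> algC) : \sum_(g in [set: gT]) F g = \sum_g F g.
  by apply: eq_bigl => h; rewrite inE.
have := cfdot_irr i i; have := cfdot_irr i 0.
rewrite (negPf chi_i0) eqxx irr0 -chi_i !cfdotE cardG !sumG !s3_sum.
rewrite !cfun1E !inE chi1 chi_s2m chi_sm chi_sigma2 conj_s conj_m.
rewrite !conjC_nat /= !mulr1 mulr0n mulr1n.
set s := chi sigma; set m := chi mu => dot1 norm1.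
have sE : s = - 1 - 3%:R / 2%:R * m.
  have -> : s = 3%:R * (6%:R^-1 * (2%:R + (s + (s + (m + (m + m))))))
    - 1 - 3%:R / 2%:R * m by field.
  by rewrite dot1; ring.
have m_eq : m * (5%:R * m + 4%:R) = 0.
  have -> : m * (5%:R * m + 4%:R) = 4%:R * (6%:R^-1 * (2%:R * 2%:R
    + (s * s + (s * s + (m * m + (m * m + m * m))))) - 1).
    by rewrite sE; field.
  by rewrite norm1 subrr mulr0.
have m0 : m = 0.
  move/eqP: m_eq; rewrite mulf_eq0 => /orP[/eqP//|/eqP m45].
  have mE : m = - (4%:R / 5%:R).
    have -> : m = ((5%:R * m + 4%:R) - 4%:R) / 5%:R by field.
    by rewrite m45 sub0r mulNr.
  have : m \is a Num.int.
    apply: Cint_rat_Aint (Aint_char _ char_chi).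
    by rewrite -/m mE rpredN rpred_div ?rpred_nat.
  case/intrP=> z mz.
  have : (5%:R * z + 4%:R)%:~R = (0 : algC).
    by rewrite rmorphD rmorphM /= -mz; exact: m45.
  move/eqP; rewrite intr_eq0 addr_eq0 => /eqP z5.
  by have: (5%:R %| 5%:R * z)%Z by [rewrite dvdz_mulr]; rewrite z5.
rewrite m0 mulr0 subr0 in sE.
have inv_s2 : ((sigma ^+ 2)^-1 = sigma)%g by rewrite -s3_invs invgK.
have inv_sm : ((sigma * mu)^-1 = sigma * mu)%g.
  by rewrite invMg s3_invs s3_invm s3_muss.
have inv_s2m : ((sigma ^+ 2 * mu)^-1 = sigma ^+ 2 * mu)%g.
  by rewrite invMg inv_s2 s3_invm s3_mus.
move: g; apply: s3_forall;
  rewrite ?(inv_s2, inv_sm, inv_s2m, s3_invs, s3_invm, invg1) /s3_c;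
  rewrite ?(chi1, chi_s2m, chi_sm, chi_sigma2) -/s -/m ?sE ?m0;
  rewrite galg_coefZ mulrA mulfV // mul1r !galg_coefE !galg_coef_elt;
  rewrite ?eqxx ?s3_eqF ?(mulr1, mulr0, sub0r, subr0, oppr0);
  by rewrite ?(ratr_nat, rmorphN1, rmorph0).
Qed.

(** The factor chi(1) / |G| = 1/3 cancels the 3 of [s3_chiE]. The idempotent thus has rational
    coefficients, which lets [LR] be studied inside Q[G]. *)
Lemma s3_central_idempotent : central_idempotent chi = map_galg ratr s3_c.
Proof.
apply: galg_eqP => g; rewrite [RHS]galg_coef_map galg_coefZ galg_coef_sum.
rewrite (bigD1 g) //= big1 ?addr0 => [|h /negPf hg]; last first.
  by rewrite galg_coefZ galg_coef_elt eq_sym hg mulr0.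
rewrite galg_coefZ galg_coef_elt eqxx mulr1 s3_chiE chi1 -cardsT cardG.
by rewrite rmorphM /= ratr_nat; field.
Qed.

End Character.

End S3.

(** * Linear relations among conjugates as a left ideal of Q[G] *)

Section RelationsAsIdeal.

Variables (C : fieldType) (L : splittingFieldType rat).
Variables (iota : {rmorphism L -> C}) (K : {subfield L}) (x : L).
Hypothesis Kx : x \in K.
Implicit Types M N : galg rat (galc K).

(** M[alpha] taken in L, before applying [iota], so that Galois automorphisms can act on the
    value. *)
Definition rat_eval M : L := \sum_g galg_coef M g *: galc_act g x.

Fact rat_eval_is_linear : linear rat_eval.
Proof.
move=> a M N; rewrite scaler_sumr -big_split; apply: eq_bigr => g _.
by rewrite galg_coefD galg_coefZ scalerDl scalerA.
Qed.

HB.instance Definition _ :=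
  GRing.isLinear.Build rat (galg rat (galc K)) L _ rat_eval rat_eval_is_linear.

Lemma rat_eval_elt g : rat_eval (galg_elt g) = galc_act g x.
Proof.
rewrite /rat_eval (bigD1 g) //= big1 ?addr0 => [|h /negPf hg].
  by rewrite galg_coef_elt eqxx scale1r.
by rewrite galg_coef_elt hg scale0r.
Qed.

Lemma iota_scale a y : iota (a *: y) = ratr a * iota y.
Proof.
rewrite -mulr_algl rmorphM; congr (_ * _).
(* A ring morphism from Q to a field can only be [ratr]. *)
exact: (fmorph_eq_rat (iota \o in_alg L)).
Qed.

Lemma galg_eval_ratr M : galg_eval iota x (map_galg ratr M) = iota (rat_eval M).
Proof.
rewrite rmorph_sum; apply: eq_bigr => g _.
by rewrite iota_scale galg_coef_map.
Qed.

(** Equivariance on the left holds because [g * h] acts as g after h in [galc K], and because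
    automorphisms are Q-linear. *)
Lemma rat_evalMl k M : rat_eval (galg_elt k * M) = galc_act k (rat_eval M).
Proof.
rewrite /rat_eval /galc_act linear_sum (reindex_inj (mulgI k)) /=.
apply: eq_bigr => g _; rewrite galg_coefMl mulKg linearZ /=; congr (_ *: _).
exact: galc_actM.
Qed.

(** The coefficient of the product at k is the sum of the M_h (k^-1 h)(alpha), that is k^-1 applied
    to M[alpha]; all of them vanish as soon as the one at k = 1 does. *)
Lemma galg_mul_resolventP M :
  map_galg ratr M * galg_resolvent iota K x = 0 <-> rat_eval M = 0.
Proof.
have coefE k : galg_coef (map_galg ratr M * galg_resolvent iota K x) k
    = iota (rat_eval (galg_elt k^-1%g * M)).
  rewrite -galg_eval_ratr galg_coefM [RHS](reindex_inj (mulgI k^-1%g)) /=.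
  apply: eq_bigr => h _; rewrite !galg_coef_map galg_coefMl invgK mulKVg.
  congr (_ * _); rewrite galg_coef_sum (bigD1 (k^-1 * h)%g) //= big1 ?addr0.
    by rewrite galg_coefZ galg_coef_elt invMg invgK eqxx mulr1.
  move=> g /negPf gkh; rewrite galg_coefZ galg_coef_elt.
  by rewrite -(inj_eq invg_inj) invMg !invgK eq_sym gkh mulr0.
split=> [M0 | M0].
  apply: (fmorph_inj iota); rewrite rmorph0 -[LHS]/(iota (rat_eval M)).
  by rewrite -[M]mul1r -[1]/(galg_elt 1%g) -{1}invg1 -coefE M0 /galg_coef ffunE.
apply: galg_eqP => k; rewrite coefE rat_evalMl M0 /galc_act linear0 rmorph0.
by rewrite /galg_coef ffunE.
Qed.

Lemma LR_P (chi : 'CF([set: galc K])) (c : galg rat (galc K)) M :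
  central_idempotent chi = map_galg ratr c ->
  LR iota x chi M <-> M * c = M /\ rat_eval M = 0.
Proof.
move=> chi_c; rewrite /LR chi_c -map_galgM.
split=> -[Mc M0]; split; try exact/galg_mul_resolventP.
  have ratr_inj : injective (ratr : rat -> algC) by exact: fmorph_inj.
  by apply/esym/(map_galg_inj ratr_inj).
by rewrite Mc.
Qed.

(** The hypothesis says that g fixes x; its fixed field then contains the field generated by x,
    which is K. *)
Lemma rat_eval1B (g : galc K) : K = <<1; x>>%VS :> {vspace L} ->
  rat_eval (galg_elt 1%g - galg_elt g) = 0 -> g = 1%g.
Proof.
rewrite linearB /= !rat_eval_elt {1}/galc_act gal_id => KE e0.
have gx : galc_act g x = x by apply/esym/eqP; rewrite -subr_eq0 e0.
apply/eqP/gal_eqP => y; rewrite {1}KE gal_id => Ky.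
have sKF : (<<1; x>> <= fixedField [set (g : gal_of K)])%VS.
  apply/FadjoinP; split; first exact: sub1v.
  by apply/fixedFieldP=> // _ /set1P->.
have /fixedFieldP := subvP sKF y Ky; apply; last exact: set11.
by rewrite KE.
Qed.

End RelationsAsIdeal.

(** * Application to LR(chi) and its relations *)

Lemma relation_rowDZ (R : comNzRingType) (gT : finGroupType) (n : nat)
    (g : 'I_n -> gT) (a b : R) (M N : galg R gT) :
  relation_row g (a *: M + b *: N)
    = a *: relation_row g M + b *: relation_row g N.
Proof. by apply/rowP=> i; rewrite !mxE galg_coefD !galg_coefZ. Qed.

Theorem theorem2 (R : realType) (f : {poly int}) (alpha : R[i])
    (L : splittingFieldType rat) (iota : {rmorphism L -> R[i]}) (x : L)
    (K : {subfield L}) (sigma mu : galc K) (chi : 'CF([set: galc K])) :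
  f \is monic -> size f = 7%N ->
  irreducible_poly (map_poly intr f : {poly rat}) ->
  root (map_poly intr f : {poly R[i]}) alpha ->
  iota x = alpha -> K = <<1; x>>%VS :> {vspace L} -> galois 1 K ->
  [set: galc K] \isog [set: 'S_3] ->
  <<[set sigma; mu]>>%g = [set: galc K] ->
  (sigma ^+ 3 = 1)%g -> (mu ^+ 2 = 1)%g ->
  (mu * sigma * mu = sigma ^+ 2)%g ->
  chi \in irr [set: galc K] -> chi 1%g = 2%:R ->
  (exists2 M, LR iota x chi M & M <> 0) ->
  let g : 'I_6 -> galc K :=
    tnth [tuple 1; sigma; sigma ^+ 2; mu; sigma * mu; sigma ^+ 2 * mu]%g in
  let alpha1 := conj_root iota x (1%g : galc K) in
  let alpha2 := conj_root iota x sigma in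
  let alpha3 := conj_root iota x (sigma ^+ 2)%g in
  let alpha4 := conj_root iota x mu in
  let alpha5 := conj_root iota x (sigma * mu)%g in
  let alpha6 := conj_root iota x (sigma ^+ 2 * mu)%g in
  let X1 : 'rV[rat]_6 := delta_mx 0 (inord 0) in
  let X2 : 'rV[rat]_6 := delta_mx 0 (inord 1) in
  let X3 : 'rV[rat]_6 := delta_mx 0 (inord 2) in
  let X4 : 'rV[rat]_6 := delta_mx 0 (inord 3) in
  let X5 : 'rV[rat]_6 := delta_mx 0 (inord 4) in
  let X6 : 'rV[rat]_6 := delta_mx 0 (inord 5) in
  let e : galc K -> galg rat (galc K) := galg_elt in
  let v1 := 3%:R^-1 *:
    (e 1%g - e sigma - e (sigma * mu)%g + e (sigma ^+ 2 * mu)%g) in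
  let v2 := - (3%:R^-1 *:
    (e sigma - e (sigma ^+ 2)%g - e mu + e (sigma * mu)%g)) in
  let admissible (a b : rat) :=
    (a, b) <> (0, 0) /\
    ratr a * (alpha1 - alpha2 - alpha5 + alpha6) =
      ratr b * (alpha2 - alpha3 - alpha4 + alpha5) in
  (exists a b, admissible a b) /\
  (forall a b, admissible a b ->
    let w := a *: v1 + b *: v2 in
    let r1 := a *: (X1 - X2 - X5 + X6) + b *: (- X2 + X3 + X4 - X5) in
    let r2 := a *: (X2 - X3 + X4 - X6) + b *: (X1 - X3 + X5 - X6) in
    [/\ is_basis (LR iota x chi) [:: w; e sigma * w],
        forall M, LR iota x chi M ->
          galg_eval iota x (map_galg ratr M) = 0,
        forall r : 'rV[rat]_6,
          (exists2 M, LR iota x chi M & r = relation_row g M) <->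
          r \in <<[:: r1; r2]>>%VS,
        ratr a * (alpha1 - alpha2 - alpha5 + alpha6)
          + ratr b * (- alpha2 + alpha3 + alpha4 - alpha5) = 0 &
        ratr a * (alpha2 - alpha3 + alpha4 - alpha6)
          + ratr b * (alpha1 - alpha3 + alpha5 - alpha6) = 0]).
Proof.
move=> _ _ _ _ _ KE _ isoG genG sigma3 mu2 msm irr_chi chi1 [M0 LRM0 M0_neq0].
move=> g alpha1 alpha2 alpha3 alpha4 alpha5 alpha6 X1 X2 X3 X4 X5 X6 e v1 v2.
move=> admissible.
have cardG : #|[set: galc K]| = 6%N by rewrite (card_isog isoG) cardsT card_Sn.
have Kx : x \in K by rewrite KE memv_adjoin.
have chi_c := s3_central_idempotent cardG genG sigma3 mu2 msm irr_chi chi1.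
have LRE M := LR_P iota Kx M chi_c.
set c := s3_c sigma in chi_c LRE.
(* Convertible to the combination of [v1] and [v2] in the statement. Its factor 1/3 is what
   separates evaluations and rows from the displayed relations. *)
pose w := s3_w sigma mu.
have evE a b : iota (rat_eval x (w a b)) = 3%:R^-1 *
    (ratr a * (alpha1 - alpha2 - alpha5 + alpha6)
      + ratr b * (- alpha2 + alpha3 + alpha4 - alpha5)).
  rewrite /rat_eval (s3_sum cardG genG) // !s3_coef_w // !rmorphD /=.
  rewrite !iota_scale !fmorph_div /= !rmorphB rmorphN /= !ratr_nat.
  rewrite -![iota (galc_act _ x)]/(conj_root iota x _).
  rewrite -/alpha1 -/alpha2 -/alpha3 -/alpha4 -/alpha5 -/alpha6.
  by field.
have ev_sigmaE a b : iota (rat_eval x (e sigma * w a b)) = 3%:R^-1 *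
    (ratr a * (alpha2 - alpha3 + alpha4 - alpha6)
      + ratr b * (alpha1 - alpha3 + alpha5 - alpha6)).
  rewrite /rat_eval (s3_sum cardG genG) // !s3_coef_sigma_w // !rmorphD /=.
  rewrite !iota_scale !fmorph_div /= !rmorphB rmorphN /= !ratr_nat.
  rewrite -![iota (galc_act _ x)]/(conj_root iota x _).
  rewrite -/alpha1 -/alpha2 -/alpha3 -/alpha4 -/alpha5 -/alpha6.
  by field.
have cancel3 (y : R[i]) : 3%:R^-1 * y = 0 -> y = 0.
  by move/eqP; rewrite mulf_eq0 invr_eq0 pnatr_eq0 => /eqP.
have ev0 y : rat_eval x y = 0 <-> iota (rat_eval x y) = 0.
  split=> [->|y0]; first by rewrite rmorph0.
  by apply: (fmorph_inj iota); rewrite y0 rmorph0.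
(* Elements of the plane are fixed by c, so membership of [w a b] in [LR] reduces to the vanishing
   of its evaluation, which is the admissibility equation up to 1/3. *)
have admP a b : admissible a b <-> (a, b) <> (0, 0) /\ LR iota x chi (w a b).
  rewrite LRE ev0 evE s3_w_c //; split=> -[ab0 H]; split=> //.
    by split=> //; rewrite H; ring.
  case: H => _ /cancel3 H.
  by apply/eqP; rewrite -subr_eq0 -H; apply/eqP; ring.
have LRD M N : LR iota x chi M -> LR iota x chi N -> LR iota x chi (M + N).
  rewrite !LRE linearD /= mulrDl => -[-> ->] [-> ->].
  by rewrite addr0.
(* Both conditions defining [LR] concern multiplication of M on the right, so they survive
   multiplication on the left. *)
have LRM M N : LR iota x chi M -> LR iota x chi (N * M).
  by case=> Mc Mr; rewrite /LR !map_galgM -!mulrA -Mc Mr mulr0.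
have LRc M : LR iota x chi M -> M * c = M by move/LRE => [].
(* Otherwise [sigma] would fix x and be the identity, against the distinctness of the six
   elements. *)
have LR1 : ~ LR iota x chi (e 1%g - e sigma).
  move/LRE => [_ /rat_eval1B - /(_ Kx KE) sigma1].
  by have := s3_uniq cardG genG sigma3 mu2 msm; rewrite sigma1 /= inE eqxx.
have ordE (i : 'I_6) k : (k < 6)%N -> (i == inord k) = (i == k :> nat).
  by move=> k6; rewrite -val_eqE /= inordK.
have rowE a b : relation_row g (w a b) = 3%:R^-1 *:
    (a *: (X1 - X2 - X5 + X6) + b *: (- X2 + X3 + X4 - X5)).
  apply/rowP; case=> -[|[|[|[|[|[|//]]]]]] lti; rewrite mxE;
    rewrite /g (tnth_nth 1%g) /= s3_coef_w // !mxE !ordE //=;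
    by field.
have row_sigmaE a b : relation_row g (e sigma * w a b) = 3%:R^-1 *:
    (a *: (X2 - X3 + X4 - X6) + b *: (X1 - X3 + X5 - X6)).
  apply/rowP; case=> -[|[|[|[|[|[|//]]]]]] lti; rewrite mxE;
    rewrite /g (tnth_nth 1%g) /= s3_coef_sigma_w // !mxE !ordE //=;
    by field.
split.
  have [a [b ab]] :=
    s3_ideal_exists cardG genG sigma3 mu2 msm LRD LRM LRc LRM0 M0_neq0.
  by exists a, b; apply/admP.
move=> a b /admP[ab0 LRw] ww r1 r2.
have [w_free w_span] :=
  s3_ideal_basis cardG genG sigma3 mu2 msm LRD LRM LRc LR1 ab0 LRw.
split.
- by split.
- by move=> M /LRE[_ M_0]; rewrite galg_eval_ratr M_0 rmorph0.
- move=> r; rewrite span_cons span_seq1; split.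
    case=> M /w_span; rewrite span_cons span_seq1.
    case/memv_addP => _ /vlineP[t ->] [_ /vlineP[t' ->] ->] ->.
    rewrite relation_rowDZ rowE row_sigmaE !scalerA.
    exact/memv_add/memvZ/memv_line/memvZ/memv_line.
  case/memv_addP => _ /vlineP[t ->] [_ /vlineP[t' ->] ->].
  (* The factors 3 undo the 1/3 of [rowE] and [row_sigmaE]. *)
  exists (t * 3%:R *: w a b + t' * 3%:R *: (e sigma * w a b)).
    apply/w_span; rewrite span_cons span_seq1.
    exact/memv_add/memvZ/memv_line/memvZ/memv_line.
  by rewrite relation_rowDZ rowE row_sigmaE !scalerA !mulfK.
- by apply: cancel3; rewrite -evE; apply/ev0; case/LRE: LRw.
(* The second relation is the evaluation of sigma w, again in the left ideal. *)
- apply: cancel3; rewrite -ev_sigmaE; apply/ev0.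
  by case/LRE: (LRM _ (e sigma) LRw).
Qed.
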